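(* Let $\mathbf{X}\in\mathbb{R}^{n\times d_x}$, $\mathbf{Y}\in\mathbb{R}^{n\times d_y}$, $\lambda_x,\lambda_y\geq 0$, and set $\Sigma_{xx}=\mathbf{X}^{T}\mathbf{X}+\lambda_x\mathbf{I}_{d_x}$, $\Sigma_{yy}=\mathbf{Y}^{T}\mathbf{Y}+\lambda_y\mathbf{I}_{d_y}$, $\Sigma_{xy}=\mathbf{X}^{T}\mathbf{Y}$, with $\Sigma_{xx},\Sigma_{yy}$ positive definite. Let $1\le p\le \min(d_x,d_y)$, let $\mathbf{N}=\mathrm{diag}(\mu_1,\dots,\mu_p)$ with $\mu_1>\dots>\mu_p>0$, and let $\mathbb{S}_{xy}=\{(\mathbf{U},\mathbf{V})\in\mathbb{R}^{d_x\times p}\times\mathbb{R}^{d_y\times p}:\mathbf{U}^{T}\Sigma_{xx}\mathbf{U}=\mathbf{I}_p,\ \mathbf{V}^{T}\Sigma_{yy}\mathbf{V}=\mathbf{I}_p\}$. Define $f_{CCA}(\mathbf{U},\mathbf{V})=-\mathrm{Tr}(\mathbf{U}^{T}\Sigma_{xy}\mathbf{V}\mathbf{N})$ on $\mathbb{S}_{xy}$. Then a point $\mathbf{Z}=(\mathbf{U},\mathbf{V})\in\mathbb{S}_{xy}$ is a critical point of $f_{CCA}$ on $\mathbb{S}_{xy}$ if and only if the columns of $\mathbf{U}$ and $\mathbf{V}$ are coordinated left and right canonical correlation vectors, not necessarily on the same phase. Moreover, the minimizers of $f_{CCA}$ on $\mathbb{S}_{xy}$ are exactly the critical points $\mathbf{Z}$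 whose columns of $\mathbf{U}$ and $\mathbf{V}$ are coordinated left and right top-$p$ canonical correlation vectors on the same phase, and if $\sigma_1>\sigma_2>\dots>\sigma_{p+1}\geq 0$ the minimizer is unique up to the signs of the columns of $\mathbf{U}$ and $\mathbf{V}$.
   Context: $\mathbb{S}_{xy}$ is a smooth embedded submanifold of $\mathbb{R}^{(d_x+d_y)\times p}$ (product of two generalized Stiefel manifolds); a critical point is a point where the Riemannian gradient of $f_{CCA}$ vanishes (equivalently, where the differential of $f_{CCA}$ restricted to the tangent space vanishes; this does not depend on the Riemannian metric). Let $\mathbf{R}=\Sigma_{xx}^{-1/2}\Sigma_{xy}\Sigma_{yy}^{-1/2}$ with singular values $\sigma_1\geq\sigma_2\geq\dots$ (the canonical correlations). The columns $\mathbf{u}_i$ of $\mathbf{U}$ and $\mathbf{v}_i$ of $\mathbf{V}$ ($i=1,\dots,p$) are called coordinated left and right canonical correlation vectors (not necessarily on the same phase) if, writing $\tilde{\mathbf{u}}_i=\Sigma_{xx}^{1/2}\mathbf{u}_i$, $\tilde{\mathbf{v}}_i=\Sigma_{yy}^{1/2}\mathbf{v}_i$, there are reals $\beta_i$ with $\mathbf{R}\tilde{\mathbf{v}}_i=\beta_i\tilde{\mathbf{u}}_i$ and $\mathbf{R}^{T}\tilde{\mathbf{u}}_i=\beta_i\tilde{\mathbf{v}}_i$ (so $|\beta_i|$ is a singular value of $\mathbf{R}$ with left/right singular vectors $\tilde{\mathbf{u}}_i,\tilde{\mathbf{v}}_i$); a pair $(\mathbf{u}_i,\mathbf{v}_i)$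 is on the same phase if $\mathbf{u}_i^{T}\mathbf{X}^{T}\mathbf{Y}\mathbf{v}_i\geq 0$. They are top-$p$ canonical correlation vectors if the corresponding singular values $|\beta_i|$ are $\sigma_1,\dots,\sigma_p$ respectively. *)

(* Defs.v *)
From HB Require Import structures.
From mathcomp Require Import all_boot all_order all_algebra.
From mathcomp Require Import all_classical all_reals all_analysis.
Set Implicit Arguments. Unset Strict Implicit. Unset Printing Implicit Defensive.
Import Order.TTheory GRing.Theory Num.Theory.
Import numFieldNormedType.Exports.
Local Open Scope ring_scope.

Section CCA.
Variable R : realType.

Definition posdef (m : nat) (A : 'M[R]_m) : Prop :=
  A^T = A /\ forall v : 'cV[R]_m, v != 0 -> 0 < (v^T *m A *m v) 0 0.
Definition possemidef (m : nat) (A : 'M[R]_m) : Prop :=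
  A^T = A /\ forall v : 'cV[R]_m, 0 <= (v^T *m A *m v) 0 0.

Definition is_psd_sqrt (m : nat) (A S : 'M[R]_m) : Prop :=
  possemidef S /\ S *m S = A.

Definition orthogonal_mx (m : nat) (P : 'M[R]_m) : Prop := P^T *m P = 1%:M.

(* s : nat -> R is the (0-indexed) sequence of singular values of A,
   s 0 >= s 1 >= ... >= 0, padded with zeros beyond min(m, n):
   A = P D Q^T with P, Q orthogonal and D the m x n "diagonal" of s. *)
Definition singular_values (m n : nat) (A : 'M[R]_(m, n)) (s : nat -> R) : Prop :=
  (forall k, 0 <= s k) /\
  (forall k, s k.+1 <= s k) /\
  (forall k, (minn m n <= k)%N -> s k = 0) /\
  exists (P : 'M[R]_m) (Q : 'M[R]_n),
    orthogonal_mx P /\ orthogonal_mx Q /\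
    A = P *m (\matrix_(i < m, j < n) (if (i == j :> nat) then s i else 0)) *m Q^T.

Definition Sig_xx (n dx : nat) (X : 'M[R]_(n, dx)) (lx : R) : 'M[R]_dx :=
  X^T *m X + lx%:M.
Definition Sig_xy (n dx dy : nat) (X : 'M[R]_(n, dx)) (Y : 'M[R]_(n, dy))
  : 'M[R]_(dx, dy) := X^T *m Y.

Definition in_Sxy (dx dy p : nat) (Sxx : 'M[R]_dx) (Syy : 'M[R]_dy)
  (U : 'M[R]_(dx, p)) (V : 'M[R]_(dy, p)) : Prop :=
  U^T *m Sxx *m U = 1%:M /\ V^T *m Syy *m V = 1%:M.

Definition f_cca (dx dy p : nat) (Sxy : 'M[R]_(dx, dy)) (N : 'M[R]_p)
  (U : 'M[R]_(dx, p)) (V : 'M[R]_(dy, p)) : R :=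
  - \tr (U^T *m Sxy *m V *m N).

(* Critical point of f on the embedded submanifold S_xy: the differential of
   f vanishes on the tangent space, i.e. for every curve t |-> (gU t, gV t)
   lying in S_xy near t = 0, passing through (U, V) at t = 0 and
   differentiable at 0, the derivative of f along the curve at 0 is 0. *)
Definition critical_pt (dx dy p : nat) (Sxx : 'M[R]_dx) (Syy : 'M[R]_dy)
  (Sxy : 'M[R]_(dx, dy)) (N : 'M[R]_p) (U : 'M[R]_(dx, p)) (V : 'M[R]_(dy, p))
  : Prop :=
  in_Sxy Sxx Syy U V /\
  forall (gU : R -> 'M[R]_(dx, p)) (gV : R -> 'M[R]_(dy, p)),
    (\forall t \near (0 : R), in_Sxy Sxx Syy (gU t) (gV t)) ->
    gU 0 = U -> gV 0 = V ->
    derivable gU 0 1 -> derivable gV 0 1 ->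
    is_derive (0 : R) (1 : R) (fun t => f_cca Sxy N (gU t) (gV t)) 0.

Definition minimizer (dx dy p : nat) (Sxx : 'M[R]_dx) (Syy : 'M[R]_dy)
  (Sxy : 'M[R]_(dx, dy)) (N : 'M[R]_p) (U : 'M[R]_(dx, p)) (V : 'M[R]_(dy, p))
  : Prop :=
  in_Sxy Sxx Syy U V /\
  forall U' V', in_Sxy Sxx Syy U' V' -> f_cca Sxy N U V <= f_cca Sxy N U' V'.

(* Columns of U, V are coordinated left/right canonical correlation vectors,
   with Hx = Sxx^{1/2}, Hy = Syy^{1/2}, Rm = Sxx^{-1/2} Sxy Syy^{-1/2}. *)
Definition coordinated (dx dy p : nat) (Hx : 'M[R]_dx) (Hy : 'M[R]_dy)
  (Rm : 'M[R]_(dx, dy)) (U : 'M[R]_(dx, p)) (V : 'M[R]_(dy, p)) : Prop :=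
  forall i : 'I_p, exists beta : R,
    Rm *m (Hy *m col i V) = beta *: (Hx *m col i U) /\
    Rm^T *m (Hx *m col i U) = beta *: (Hy *m col i V).

(* ... and moreover top-p: |beta_i| = sigma_{i+1} (0-indexed s i) *)
Definition coordinated_top (dx dy p : nat) (Hx : 'M[R]_dx) (Hy : 'M[R]_dy)
  (Rm : 'M[R]_(dx, dy)) (s : nat -> R) (U : 'M[R]_(dx, p)) (V : 'M[R]_(dy, p))
  : Prop :=
  forall i : 'I_p, exists beta : R,
    Rm *m (Hy *m col i V) = beta *: (Hx *m col i U) /\
    Rm^T *m (Hx *m col i U) = beta *: (Hy *m col i V) /\
    `|beta| = s i.

Definition same_phase (n dx dy p : nat) (X : 'M[R]_(n, dx)) (Y : 'M[R]_(n, dy))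
  (U : 'M[R]_(dx, p)) (V : 'M[R]_(dy, p)) : Prop :=
  forall i : 'I_p, 0 <= ((col i U)^T *m X^T *m Y *m col i V) 0 0.

Definition sign_mx (p : nat) (e : 'I_p -> bool) : 'M[R]_p :=
  diag_mx (\row_i (if e i then -1 else 1)).

End CCA.

(* Main.v *)
Require Import Defs.
From HB Require Import structures.
From mathcomp Require Import all_boot all_order all_algebra.
From mathcomp Require Import all_classical all_reals all_analysis ring.
Import Order.TTheory GRing.Theory Num.Theory.
Import numFieldNormedType.Exports.
Local Open Scope ring_scope.

(** Put A = Sxx^{1/2} U and B = Syy^{1/2} V, which have orthonormal columns, and
    T = Sxx^{-1/2} Sxy Syy^{-1/2}, so that the objective is - Tr (A^T T B N).
    Moving A by plane rotations shows that at a critical point (or at a minimizer)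
    T B N A^T is symmetric, and likewise T^T A N B^T.  Then M = A^T T B satisfies
    M N = N M^T and M^T N = N M, hence commutes with N^2 and is diagonal, which gives
    T B = A M and T^T A = B M.
    For the minimizers, Ky Fan's inequality bounds the partial sums of the diagonal of M
    by those of the singular values; summation by parts against the decreasing weights mu
    turns this into Tr (M N) <= sum_i mu_i s_i, with equality only if M_ii = s_i for all i.
    When s_0 > ... > s_p, the eigenspaces of T^T T and T T^T for s_0^2, ..., s_{p-1}^2
    are lines, whence uniqueness up to signs. *)

(** * Differentiation of matrix-valued curves *)

Lemma is_derive_mxP {R : realFieldType} {m n : nat} (M : R -> 'M[R]_(m, n)) (t : R)
  (dM : 'M[R]_(m, n)) :
  is_derive t 1 M dM <-> forall i j, is_derive t 1 (fun x => M x i j) (dM i j).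
Proof.
split=> [[Md <-] i j|Md].
  rewrite derive_mx // mxE; apply: derivableP.
  exact: ((derivable_mxP _ _ _).1 Md).
have Md' : derivable M t 1.
  by apply/derivable_mxP => i j; have [] := Md i j.
split=> //; rewrite derive_mx //; apply/matrixP => i j; rewrite mxE.
by have [] := Md i j.
Qed.

Lemma is_derive_fsum {R : realFieldType} {n : nat} {F : 'I_n -> R -> R} {dF : 'I_n -> R} {t : R} :
  (forall i, is_derive t 1 (F i) (dF i)) ->
  is_derive t 1 (fun x => \sum_(i < n) F i x) (\sum_(i < n) dF i).
Proof.
move=> FdF; have := is_derive_sum FdF.
by congr (is_derive _ _ _ _); apply/funext => x; rewrite fct_sumE.
Qed.

Lemma is_derive_mulmx {R : realFieldType} {m n p : nat}
  {F : R -> 'M[R]_(m, n)} {G : R -> 'M[R]_(n, p)} {t : R} {dF dG} :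
  is_derive t 1 F dF -> is_derive t 1 G dG ->
  is_derive t 1 (fun x => F x *m G x) (dF *m G t + F t *m dG).
Proof.
move=> /is_derive_mxP dF' /is_derive_mxP dG'; apply/is_derive_mxP => i j.
under eq_fun do rewrite mxE.
rewrite !mxE -big_split /=; apply: is_derive_fsum => k.
have := is_deriveM (dF' i k) (dG' k j).
by congr (is_derive _ _ _ _); rewrite addrC [_ *: dF i k]mulrC.
Qed.

Lemma is_derive_trmx {R : realFieldType} {m n : nat} {F : R -> 'M[R]_(m, n)} {t : R} {dF} :
  is_derive t 1 F dF -> is_derive t 1 (fun x => (F x)^T) dF^T.
Proof.
move=> /is_derive_mxP dF'; apply/is_derive_mxP => i j.
by under eq_fun do rewrite mxE; rewrite mxE.
Qed.

Lemma is_derive_mxtrace {R : realFieldType} {n : nat} {F : R -> 'M[R]_n} {t : R} {dF} :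
  is_derive t 1 F dF -> is_derive t 1 (fun x => \tr (F x)) (\tr dF).
Proof. by move=> /is_derive_mxP dF'; apply: is_derive_fsum. Qed.

Lemma is_derive_f_cca {R : realType} {dx dy p : nat} (S : 'M[R]_(dx, dy)) (N : 'M[R]_p)
  {U : R -> 'M[R]_(dx, p)} {V : R -> 'M[R]_(dy, p)} {t : R} {dU dV} :
  is_derive t 1 U dU -> is_derive t 1 V dV ->
  is_derive t 1 (fun x => f_cca S N (U x) (V x))
    (- (\tr (dU^T *m S *m V t *m N) + \tr ((U t)^T *m S *m dV *m N))).
Proof.
move=> Ud Vd; rewrite /f_cca.
have cstd k l (C : 'M[R]_(k, l)) : is_derive t 1 (fun=> C) 0 by exact: is_derive_cst.
have := is_derive_mxtrace (is_derive_mulmx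
  (is_derive_mulmx (is_derive_mulmx (is_derive_trmx Ud) (cstd _ _ S)) Vd) (cstd _ _ N)).
move/is_deriveN; congr (is_derive _ _ _ (- _)).
by rewrite !mulmx0 !addr0 mulmxDl raddfD.
Qed.

(** Differentiating [(g t)^T *m T *m g t = 1%:M] makes [dg^T *m T *m g 0] skew-symmetric, and a
    skew-symmetric matrix times a diagonal one has trace zero. Under the gradient hypotheses both
    terms of the derivative of [f_cca] are such traces. *)
Lemma critical_of_diag_gradients {R : realType} {dx dy p : nat} (Sxx : 'M[R]_dx)
  (Syy : 'M[R]_dy) (S : 'M[R]_(dx, dy)) (mu d : 'rV[R]_p)
  (U : 'M[R]_(dx, p)) (V : 'M[R]_(dy, p)) :
  Sxx^T = Sxx -> Syy^T = Syy -> in_Sxy Sxx Syy U V ->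
  S *m V = Sxx *m U *m diag_mx d -> S^T *m U = Syy *m V *m diag_mx d ->
  critical_pt Sxx Syy S (diag_mx mu) U V.
Proof.
move=> Sx Sy USV SV SU; split=> // gU gV gin gU0 gV0 /derivableP dgU /derivableP dgV.
set dU := 'D_1 gU 0 in dgU; set dV := 'D_1 gV 0 in dgV.
have skew k (T : 'M[R]_k) (g : R -> 'M[R]_(k, p)) (dg : 'M[R]_(k, p)) : T^T = T ->
    is_derive (0 : R) (1 : R) g dg -> (\forall t \near (0 : R), (g t)^T *m T *m g t = 1%:M) ->
    forall e : 'rV[R]_p, \tr (dg^T *m (T *m g 0) *m diag_mx e) = 0.
  move=> TT gd gn e.
  have cstd : is_derive (0:R) 1 (fun=> T) 0 by exact: is_derive_cst.
  have d1 := is_derive_mulmx (is_derive_mulmx (is_derive_trmx gd) cstd) gd.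
  have d2 : is_derive (0:R) 1 (fun t => (g t)^T *m T *m g t) 0.
    have c1 : is_derive (0:R) 1 (fun=> 1%:M : 'M[R]_p) 0 by exact: is_derive_cst.
    by apply: near_eq_is_derive c1; apply: filterS gn => t ->.
  have := @derive_val _ _ _ _ _ _ _ d1; rewrite (@derive_val _ _ _ _ _ _ _ d2).
  rewrite mulmx0 addr0 => /esym /eqP; rewrite addr_eq0 => /eqP E.
  have : \tr (dg^T *m (T *m g 0) *m diag_mx e) = - \tr (dg^T *m (T *m g 0) *m diag_mx e).
    rewrite {1}mulmxA E mulNmx raddfN /= -mxtrace_tr !trmx_mul tr_diag_mx trmxK TT.
    by rewrite mxtrace_mulC !mulmxA.
  by move/eqP; rewrite -addr_eq0 -mulr2n mulrn_eq0 /= => /eqP.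
have := is_derive_f_cca S (diag_mx mu) dgU dgV.
congr (is_derive _ _ _ _); rewrite gU0 gV0.
(* [diag_mx d *m diag_mx mu] is again diagonal, so [skew] applies to the [U] term; the [V] term is
   then transposed into the same shape. *)
rewrite -[dU^T *m S *m V]mulmxA SV !mulmxA -[_ *m diag_mx d *m _]mulmxA mulmx_diag.
rewrite -(mulmxA _ Sxx) -[X in _ *m (Sxx *m X)]gU0 (skew _ _ _ _ Sx dgU); last first.
  by apply: filterS gin => t [].
rewrite add0r -mxtrace_tr !trmx_mul tr_diag_mx trmxK mxtrace_mulC !mulmxA.
rewrite -[dV^T *m S^T *m U]mulmxA SU !mulmxA -[_ *m diag_mx d *m _]mulmxA mulmx_diag.
rewrite -(mulmxA _ Syy) -[X in _ *m (Syy *m X)]gV0 (skew _ _ _ _ Sy dgV) ?oppr0 //.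
by apply: filterS gin => t [].
Qed.

(** * Plane rotations *)

(** For [i != j], the rotation by [t] in the plane of these two coordinates; matrix units keep its
    products and derivative purely algebraic. *)
Definition givens_mx {R : realType} {d : nat} (i j : 'I_d) (t : R) : 'M[R]_d :=
  1%:M + (cos t - 1) *: (delta_mx i i + delta_mx j j)
       + sin t *: (delta_mx i j - delta_mx j i).

Lemma givens_mx0 {R : realType} {d : nat} (i j : 'I_d) : givens_mx i j (0 : R) = 1%:M.
Proof. by rewrite /givens_mx cos0 sin0 subrr !scale0r !addr0. Qed.

(** [K] is the projection onto the plane and [W] a quarter turn in it: [K W = W K = W] and
    [W^2 = - K]. In the product the [W] terms cancel, and the coefficient of [K] vanishes by
    [cos^2 + sin^2 = 1]. *)
Lemma givens_mx_orthogonal {R : realType} {d : nat} (i j : 'I_d) (t : R) :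
  i != j -> orthogonal_mx (givens_mx i j t).
Proof.
move=> ij; rewrite /orthogonal_mx /givens_mx.
set K := delta_mx i i + _; set W := delta_mx i j - _.
have ji : j != i by rewrite eq_sym.
have KT : K^T = K by rewrite /K raddfD /= !trmx_delta.
have WT : W^T = - W by rewrite /W raddfB /= !trmx_delta opprB.
have KK : K *m K = K.
  by rewrite /K !(mulmxDl, mulmxDr) !mul_delta_mx !mul_delta_mx_0 // addr0 add0r.
have KW : K *m W = W.
  rewrite /K /W !(mulmxDl, mulmxDr, mulmxN, mulNmx) !mul_delta_mx !mul_delta_mx_0 //.
  by rewrite !oppr0 addr0 add0r.
have WK : W *m K = W.
  rewrite /K /W !(mulmxDl, mulmxDr, mulmxN, mulNmx) !mul_delta_mx !mul_delta_mx_0 //.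
  by rewrite !oppr0 addr0 add0r.
have WW : W *m W = - K.
  rewrite /K /W !(mulmxDl, mulmxDr, mulmxN, mulNmx) !mul_delta_mx !mul_delta_mx_0 //.
  by rewrite ?oppr0 ?opprK !(add0r, addr0, subr0, sub0r) opprD.
have -> : (1%:M + (cos t - 1) *: K + sin t *: W)^T = 1%:M + (cos t - 1) *: K - sin t *: W.
  by rewrite linearD linearD /= !linearZ /= KT WT trmx1 scalerN.
rewrite !(mulmxDl, mulmxDr, mulNmx) !mul1mx !mulmx1.
rewrite -!(scalemxAl, scalemxAr) ?mulmxN ?mulNmx KK KW WK WW.
clearbody K W.
have e : (cos t - 1) * (cos t - 1) + (cos t - 1) + (cos t - 1) + sin t * sin t = 0.
  have := cos2Dsin2 t; rewrite !expr2 => E.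
  transitivity (cos t * cos t + sin t * sin t - 1); last by rewrite E subrr.
  by ring.
apply/matrixP => a b; rewrite !mxE.
transitivity ((a == b)%:R + ((cos t - 1) * (cos t - 1) + (cos t - 1) + (cos t - 1)
  + sin t * sin t) * K a b); first by ring.
by rewrite e mul0r addr0.
Qed.

Lemma is_derive_givens_mx {R : realType} {d : nat} (i j : 'I_d) (t : R) :
  is_derive t 1 (givens_mx i j)
    (- sin t *: (delta_mx i i + delta_mx j j) + cos t *: (delta_mx i j - delta_mx j i)).
Proof.
apply/is_derive_mxP => a b; rewrite mxE [X in X + _]mxE [X in _ + X]mxE.
set K := delta_mx i i + _; set W := delta_mx i j - _.
have -> : (fun x => givens_mx i j x a b) =
    (cst ((a == b)%:R - K a b) + (K a b \*: cos + W a b \*: sin) : R -> R).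
  apply/funext => x; rewrite /givens_mx -/K -/W mxE [X in X + _]mxE [X in _ + X]mxE.
  rewrite [X in X + _ + _]mxE [X in _ + X + _]mxE !fctE /= /GRing.scale /=.
  by move: (K a b) (W a b) => k w; ring.
move: (K a b) (W a b) => k w.
have := is_deriveD (is_derive_cst ((a == b)%:R - k) t (1 : R))
  (is_deriveD (is_deriveZ k (is_derive_cos t)) (is_deriveZ w (is_derive_sin t))).
by congr (is_derive _ _ _ _); rewrite add0r; congr (_ + _); apply: mulrC.
Qed.

(** * Ky Fan's inequality and the trace inequality *)

(** Abel summation. The boundary term carries [m p], one index past the last weight in the sum; it
    disappears when the weights are extended by zero. *)
Lemma sum_by_parts {R : comPzRingType} (m x : nat -> R) (p : nat) :
  \sum_(i < p) m i * x i =
  m p * (\sum_(i < p) x i) + \sum_(i < p) (m i - m i.+1) * \sum_(j < i.+1) x j.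
Proof.
elim: p => [|p IH]; first by rewrite !big_ord0 mulr0 addr0.
by rewrite !big_ord_recr /= IH; ring.
Qed.

Section DecreasingWeights.
Variables (R : realDomainType) (m x : nat -> R) (p : nat).
Hypothesis m_p : m p = 0.
Hypothesis m_dec : forall i, (i < p)%N -> m i.+1 < m i.
Hypothesis x_ge0 : forall k, (k <= p)%N -> 0 <= \sum_(i < k) x i.

Lemma sum_decreasing_weights_ge0 : 0 <= \sum_(i < p) m i * x i.
Proof.
rewrite sum_by_parts m_p mul0r add0r; apply: sumr_ge0 => i _.
by rewrite mulr_ge0 ?x_ge0 // subr_ge0 ltW ?m_dec.
Qed.

(** After summation by parts every term is nonnegative, so each is zero; the strict decrease of [m]
    then kills all partial sums of [x], hence [x] itself. *)
Lemma sum_decreasing_weights_eq0 :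
  \sum_(i < p) m i * x i = 0 -> forall i, (i < p)%N -> x i = 0.
Proof.
rewrite sum_by_parts m_p mul0r add0r => /eqP.
rewrite psumr_eq0 => [|i _]; last by rewrite mulr_ge0 ?x_ge0 // subr_ge0 ltW ?m_dec.
move=> /allP X0.
have {}X0 k : (k <= p)%N -> \sum_(i < k) x i = 0.
  case: k => [_|k kp]; first by rewrite big_ord0.
  have /= := X0 (Ordinal kp) (mem_index_enum _).
  by rewrite mulf_eq0 subr_eq0 gt_eqF ?m_dec //= => /eqP.
by move=> i ip; have := X0 _ ip; rewrite big_ord_recr /= X0 ?add0r // ltnW.
Qed.

End DecreasingWeights.

(** The sum is the diagonal entry [P j j] of the orthogonal projection [A *m A^T]; symmetry and
    idempotence give [P j j ^+ 2 <= P j j]. *)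
Lemma bessel_unit_vectors {R : realDomainType} {m p : nat} (A : 'M[R]_(m, p)) (j : 'I_m) :
  A^T *m A = 1%:M -> \sum_i A j i ^+ 2 <= 1.
Proof.
move=> AA; set P := A *m A^T.
have PP : P *m P = P by rewrite /P mulmxA -(mulmxA A) AA mulmx1.
have PT : P^T = P by rewrite /P trmx_mul trmxK.
have Pj : P j j = \sum_i A j i ^+ 2.
  by rewrite mxE; apply: eq_bigr => i _; rewrite mxE expr2.
have Pjj : P j j ^+ 2 <= P j j.
  have Pjl : P j j = \sum_l P j l * P l j by rewrite -[in LHS]PP mxE.
  rewrite [leRHS]Pjl (bigD1 j) //= expr2 lerDl.
  apply: sumr_ge0 => l _.
  have -> : P l j = P j l by rewrite -[in LHS]PT mxE.
  by rewrite -expr2 sqr_ge0.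
rewrite -Pj leNgt; apply/negP => P1.
by move: Pjj; rewrite leNgt expr2 ltr_pMr ?P1 // (lt_trans ltr01).
Qed.

Definition sv_mx {R : pzSemiRingType} (m n : nat) (s : nat -> R) : 'M[R]_(m, n) :=
  \matrix_(i, j) (if (i == j :> nat) then s i else 0).

Lemma tr_sv_mx {R : pzSemiRingType} (m n : nat) (s : nat -> R) :
  (sv_mx m n s)^T = sv_mx n m s.
Proof.
by apply/matrixP => i j; rewrite !mxE eq_sym; case: eqP => // ->.
Qed.

Section KyFan.
Variables (R : realFieldType) (s : nat -> R).
Hypothesis s_ge0 : forall k, 0 <= s k.
Hypothesis s_dec : forall k, s k.+1 <= s k.

Let s_antitone k l : (k <= l)%N -> s l <= s k.
Proof. exact: (nonincreasing_seqP s).1. Qed.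

(** The squared row norms [w j] of the first [k] columns lie in [0, 1] and sum to [k]. As [s] is
    nonincreasing, the weighted sum is largest when all the weight sits on the first [k] indices. *)
Lemma weighted_row_norm_le {m p : nat} (A : 'M[R]_(m, p)) (k : nat) :
  A^T *m A = 1%:M -> (k <= p)%N ->
  \sum_(i < p | (i < k)%N) \sum_(j < _) s j * A j i ^+ 2 <= \sum_(i < k) s i.
Proof.
move=> AA kp.
have km : (k <= m)%N by rewrite (leq_trans kp) // (mulmx1_min AA).
rewrite exchange_big /= (big_ord_widen m) // [leRHS]big_mkcond /= -subr_ge0 -sumrB.
set w := fun j : 'I_m => \sum_(i < p | (i < k)%N) A j i ^+ 2.
have wsum : \sum_j w j = k%:R.
  rewrite /w exchange_big /= (eq_bigr (fun=> 1)) => [|i _].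
    by rewrite -(big_ord_widen p (fun=> 1)) // sumr_const card_ord.
  have <- : (A^T *m A) i i = 1 by rewrite AA mxE eqxx.
  rewrite mxE.
  by apply: eq_bigr => j _; rewrite mxE expr2.
have ksum : \sum_(j < m) (j < k)%:R = k%:R :> R.
  transitivity (\sum_(i < k) (1 : R)); last by rewrite sumr_const card_ord.
  rewrite (big_ord_widen m (fun=> 1 : R)) // [RHS]big_mkcond /=.
  by apply: eq_bigr => j _; case: ifP.
have w_ge0 j : 0 <= w j by apply: sumr_ge0 => i _; rewrite sqr_ge0.
have w_le1 j : w j <= 1.
  apply: le_trans (bessel_unit_vectors A j AA); rewrite /w big_mkcond /=.
  by apply: ler_sum => i _; case: ifP => // _; rewrite sqr_ge0.
(* Both weightings have total [k], so zero can be written with the threshold [s k]; the comparison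
   then holds term by term, on either side of [k]. *)
rewrite [leLHS](_ : 0 = \sum_(j < m) s k * ((j < k)%:R - w j)); last first.
  by rewrite -mulr_sumr sumrB wsum ksum subrr mulr0.
apply: ler_sum => j _; rewrite -mulr_sumr -/(w j).
case: ltnP => jk /=.
  rewrite -[X in _ <= X - _]mulr1 -mulrBr ler_wpM2r ?subr_ge0 ?s_antitone ?w_le1 //.
  exact: ltnW.
by rewrite !sub0r !mulrN lerN2 ler_wpM2r ?s_antitone.
Qed.

Let sv_row_sum {m n : nat} (j : 'I_m) :
  \sum_(l < n) (if (j == l :> nat) then s j else 0) <= s j.
Proof.
case: (ltnP j n) => jn.
  rewrite (bigD1 (Ordinal jn)) //= eqxx big1 ?addr0 // => l lj.
  by case: eqP => // e; case/eqP: lj; apply: val_inj; rewrite /= e.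
rewrite big1 ?s_ge0 // => l _; case: eqP => // e.
by move: jn; rewrite e leqNgt ltn_ord.
Qed.

(** The inequality [2 a b <= a^2 + b^2] splits the bilinear sum into weighted sums of squares for
    [A] and for [B], each bounded by [weighted_row_norm_le]. *)
Lemma ky_fan {m n p : nat} (A : 'M[R]_(m, p)) (B : 'M[R]_(n, p)) (k : nat) :
  A^T *m A = 1%:M -> B^T *m B = 1%:M -> (k <= p)%N ->
  \sum_(i < p | (i < k)%N) (A^T *m sv_mx m n s *m B) i i <= \sum_(i < k) s i.
Proof.
move=> AA BB kp.
have HA := weighted_row_norm_le A k AA kp; have HB := weighted_row_norm_le B k BB kp.
suff : \sum_(i < p | (i < k)%N) (A^T *m sv_mx m n s *m B) i i *+ 2 <=
    \sum_(i < p | (i < k)%N) \sum_(j < _) s j * A j i ^+ 2 +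
    \sum_(i < p | (i < k)%N) \sum_(j < _) s j * B j i ^+ 2.
  rewrite sumrMnl => le2; rewrite -(ler_pMn2r (_ : 0 < 2)%N) // (le_trans le2) //.
  by rewrite mulr2n lerD.
rewrite -big_split /=; apply: ler_sum => i _.
have -> : (A^T *m sv_mx m n s *m B) i i =
    \sum_(j < m) \sum_(l < n) (if (j == l :> nat) then s j else 0) * (A j i * B l i).
  rewrite mxE (eq_bigr (fun l : 'I_n => \sum_(j < m) (if (j == l :> nat) then s j else 0)
      * (A j i * B l i))) => [|l _]; first exact: exchange_big.
  by rewrite mxE mulr_suml; apply: eq_bigr => j _; rewrite !mxE mulrAC mulrC.
rewrite -sumrMnl.
apply: (@le_trans _ _ (\sum_(j < m) \sum_(l < n) (if (j == l :> nat) then s j else 0) * A j i ^+ 2 +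
                       \sum_(l < n) \sum_(j < m) (if (l == j :> nat) then s l else 0) * B l i ^+ 2)).
  rewrite [X in _ + X]exchange_big /= -big_split /=; apply: ler_sum => j _.
  rewrite -sumrMnl -big_split /=; apply: ler_sum => l _.
  rewrite eq_sym; case: eqP => [<-|_]; last by rewrite !mul0r mul0rn addr0.
  rewrite -mulrnAr -mulrDr ler_wpM2l // -subr_ge0.
  have -> : A j i ^+ 2 + B l i ^+ 2 - A j i * B l i *+ 2 = (A j i - B l i) ^+ 2 by ring.
  exact: sqr_ge0.
by apply: lerD; apply: ler_sum => j _; rewrite -mulr_suml ler_wpM2r ?sqr_ge0 // sv_row_sum.
Qed.

End KyFan.

Lemma orthogonal_mul_isometry {R : realType} {m p : nat} (P : 'M[R]_m) (A : 'M[R]_(m, p)) :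
  orthogonal_mx P -> A^T *m A = 1%:M -> (P^T *m A)^T *m (P^T *m A) = 1%:M.
Proof.
move=> /mulmx1C PP AA.
by rewrite trmx_mul trmxK -mulmxA (mulmxA P) PP mul1mx.
Qed.

Section TraceInequality.
Variables (R : realType) (dx dy p : nat) (P : 'M[R]_dx) (Q : 'M[R]_dy) (s : nat -> R).
Variables (mu : 'rV[R]_p) (A : 'M[R]_(dx, p)) (B : 'M[R]_(dy, p)).
Hypotheses (PP : orthogonal_mx P) (QQ : orthogonal_mx Q).
Hypotheses (s_ge0 : forall k, 0 <= s k) (s_dec : forall k, s k.+1 <= s k).
Hypothesis mu_dec : forall i j : 'I_p, (i < j)%N -> mu 0 j < mu 0 i.
Hypothesis mu_pos : forall i, 0 < mu 0 i.
Hypotheses (AA : A^T *m A = 1%:M) (BB : B^T *m B = 1%:M).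

Let M := A^T *m (P *m sv_mx dx dy s *m Q^T) *m B.
(** Extension by zero from ['I_p] to all naturals: it supplies the value [m p = 0] and allows sums
    over initial segments. *)
Let ext (F : 'I_p -> R) (k : nat) : R := oapp F 0 (insub k).
Let m := ext (fun i => mu 0 i).
Let x k := s k - ext (fun i => M i i) k.

Let ext_ord F (i : 'I_p) : ext F i = F i.
Proof. by rewrite /ext valK. Qed.

Let m_p : m p = 0.
Proof. by rewrite /m /ext insubF ?ltnn. Qed.

Let m_dec i : (i < p)%N -> m i.+1 < m i.
Proof.
move=> ip; rewrite -[i in ltRHS]/(nat_of_ord (Ordinal ip)) /m ext_ord.
(* At the last index the next weight is the padding value 0, so the decrease there comes from the
   positivity of [mu]. *)
case: (ltnP i.+1 p) => [i1p|pi1]; last by rewrite /ext insubF ?mu_pos // ltnNge pi1.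
by rewrite -[i.+1]/(nat_of_ord (Ordinal i1p)) ext_ord mu_dec.
Qed.

Let x_ge0 k : (k <= p)%N -> 0 <= \sum_(i < k) x i.
Proof.
move=> kp; rewrite sumrB subr_ge0 (big_ord_widen p) //.
under eq_bigr do rewrite ext_ord.
have := ky_fan R s s_ge0 s_dec (P^T *m A) (Q^T *m B) k (orthogonal_mul_isometry _ _ PP AA)
  (orthogonal_mul_isometry _ _ QQ BB) kp.
by rewrite trmx_mul trmxK !mulmxA /M !mulmxA.
Qed.

Let sum_mx : \sum_(i < p) m i * x i = \sum_i mu 0 i * s i - \sum_i mu 0 i * M i i.
Proof.
rewrite -sumrB; apply: eq_bigr => i _.
by rewrite /m /x !ext_ord mulrBr.
Qed.

Lemma trace_inequality : \sum_i mu 0 i * M i i <= \sum_i mu 0 i * s i.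
Proof. by rewrite -subr_ge0 -sum_mx; exact: sum_decreasing_weights_ge0. Qed.

Lemma trace_equality :
  \sum_i mu 0 i * M i i = \sum_i mu 0 i * s i -> forall i, M i i = s i.
Proof.
move=> E i; have := @sum_decreasing_weights_eq0 _ m x p m_p m_dec x_ge0.
rewrite sum_mx E subrr => /(_ erefl i (ltn_ord i)) /eqP.
by rewrite subr_eq0 ext_ord => /eqP ->.
Qed.

End TraceInequality.

(** * Singular bases *)

(** The first [p] coordinate vectors are singular vectors of [sv_mx]; this yields a feasible point
    attaining the trace bound. *)
Lemma sv_mx_mul_pid {R : pzSemiRingType} (m n p : nat) (s : nat -> R) :
  (p <= m)%N -> (p <= n)%N ->
  sv_mx m n s *m (pid_mx p : 'M[R]_(n, p)) = pid_mx p *m diag_mx (\row_i s i).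
Proof.
move=> pm pn; apply/matrixP => j i; rewrite mul_mx_diag !mxE.
rewrite (bigD1 (widen_ord pn i)) //= big1 => [|l li]; last first.
  rewrite !mxE [X in (X && _)](_ : _ = false) ?mulr0 //.
  by apply: contraNF li => /eqP e; apply/eqP/val_inj.
rewrite !mxE /= eqxx ltn_ord /= mulr1 addr0.
by case: eqP => [->|_]; rewrite ?ltn_ord ?mul1r ?mul0r.
Qed.

Lemma sv_mx_mul_tr {R : pzSemiRingType} (m n : nat) (s : nat -> R) :
  (forall k, (m <= k)%N -> s k = 0) ->
  sv_mx n m s *m sv_mx m n s = diag_mx (\row_j s j ^+ 2).
Proof.
move=> s0; apply/matrixP => j l; rewrite !mxE.
case: (ltnP j m) => jm; last first.
  rewrite s0 // expr0n /= mul0rn big1 // => k _; rewrite mxE.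
  by rewrite s0 // if_same mul0r.
rewrite (bigD1 (Ordinal jm)) //= big1 => [|k kj]; last first.
  rewrite !mxE; case: eqP => [e|_]; last by rewrite mul0r.
  by case/eqP: kj; apply: val_inj.
rewrite !mxE /= eqxx addr0 expr2.
by rewrite val_eqE; case: eqP => _; rewrite ?mulr0.
Qed.

(** Entrywise, [(t j - t i) * C j i = 0], so only entries with equal row and column index survive,
    and the unit norm of each column makes them 1 or -1. *)
Lemma diag_eigenbasis_unique {R : realType} {n p : nat} (t : nat -> R) (C C' : 'M[R]_(n, p)) :
  diag_mx (\row_j t j) *m C = C *m diag_mx (\row_i t i) ->
  diag_mx (\row_j t j) *m C' = C' *m diag_mx (\row_i t i) ->
  C^T *m C = 1%:M -> C'^T *m C' = 1%:M ->
  (forall (i : 'I_p) (j : 'I_n), j != i :> nat -> t j != t i) ->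
  exists e : 'I_p -> bool, C' = C *m sign_mx R e.
Proof.
move=> CE CE' CC CC' tinj.
have off (X : 'M[R]_(n, p)) : diag_mx (\row_j t j) *m X = X *m diag_mx (\row_i t i) ->
    forall (i : 'I_p) (j : 'I_n), j != i :> nat -> X j i = 0.
  move=> XE i j ji; have /matrixP/(_ j i) := XE.
  rewrite mul_diag_mx mul_mx_diag !mxE mulrC => /eqP.
  by rewrite -subr_eq0 -mulrBr mulf_eq0 subr_eq0 (negbTE (tinj _ _ ji)) orbF => /eqP.
have on (X : 'M[R]_(n, p)) : diag_mx (\row_j t j) *m X = X *m diag_mx (\row_i t i) ->
    X^T *m X = 1%:M -> forall (i : 'I_p) (j : 'I_n), j = i :> nat -> X j i ^+ 2 = 1.
  move=> XE XX i j ji; have : (X^T *m X) i i = 1 by rewrite XX mxE eqxx.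
  rewrite mxE (bigD1 j) //= big1 => [|k kj].
    by rewrite addr0 mxE expr2.
  rewrite (off _ XE) ?mulr0 // -ji; apply: contraNneq kj => e; exact/eqP/val_inj.
(* Columns [i] of [C] and [C'] can differ only in row [i], so any difference means a flipped
   sign. *)
exists (fun i => [exists j, C' j i != C j i]).
apply/matrixP => j i; rewrite mul_mx_diag !mxE.
case: (eqVneq (j : nat) i) => [ji|ji]; last by rewrite !off // mul0r.
case: existsP => [[k]|H]; last first.
  by rewrite mulr1; apply/eqP/negPn/negP => H'; apply: H; exists j.
case: (eqVneq (k : nat) i) => [ki|ki]; last by rewrite (off _ CE _ _ ki) (off _ CE' _ _ ki) eqxx.
have -> : k = j by apply: val_inj; rewrite /= ki ji.
have /eqP : C' j i ^+ 2 = C j i ^+ 2 by rewrite !on.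
by rewrite eqf_sqr => /orP[/eqP ->|/eqP -> _]; rewrite ?eqxx // mulrN1.
Qed.

(** In the basis [Q] the matrix [T^T *m T] is diagonal with entries [s j ^+ 2], and the columns of
    [Q^T *m B] are eigenvectors for the first [p] of them. The strict drops, including the one from
    [s p.-1] to [s p], separate each of these from all other entries. *)
Lemma right_singular_vectors_unique {R : realType} {m n p : nat} (P : 'M[R]_m) (Q : 'M[R]_n)
  (s : nat -> R) (A A' : 'M[R]_(m, p)) (B B' : 'M[R]_(n, p)) :
  let T := P *m sv_mx m n s *m Q^T in
  let D := diag_mx (\row_(i < p) s i) in
  orthogonal_mx P -> orthogonal_mx Q ->
  (forall k, 0 <= s k) -> (forall k, s k.+1 <= s k) -> (forall k, (m <= k)%N -> s k = 0) ->
  (forall k, (k < p)%N -> s k.+1 < s k) ->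
  T *m B = A *m D -> T^T *m A = B *m D -> T *m B' = A' *m D -> T^T *m A' = B' *m D ->
  B^T *m B = 1%:M -> B'^T *m B' = 1%:M ->
  exists e : 'I_p -> bool, B' = B *m sign_mx R e.
Proof.
move=> T D PP QQ s_ge0 s_dec s0 s_lt TB TA TB' TA' BB BB'.
have QQ' := mulmx1C QQ.
have s_antitone k l : (k <= l)%N -> s l <= s k by exact: (nonincreasing_seqP s).1.
have TTQ : T^T *m T *m Q = Q *m diag_mx (\row_j s j ^+ 2).
  rewrite -(sv_mx_mul_tr m n s s0) /T !trmx_mul trmxK tr_sv_mx -!mulmxA QQ mulmx1.
  by rewrite (mulmxA P^T) PP mul1mx.
have diagE : diag_mx (\row_j s j ^+ 2) = Q^T *m (T^T *m T *m Q).
  by rewrite TTQ mulmxA QQ mul1mx.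
clearbody T.
have eig (X : 'M[R]_(n, p)) (Y : 'M[R]_(m, p)) : T *m X = Y *m D -> T^T *m Y = X *m D ->
    diag_mx (\row_j s j ^+ 2) *m (Q^T *m X) = Q^T *m X *m diag_mx (\row_i s i ^+ 2).
  move=> TX TY; rewrite diagE -!mulmxA (mulmxA Q) QQ' mul1mx TX.
  rewrite (mulmxA T^T) TY -!mulmxA mulmx_diag; congr (_ *m (_ *m diag_mx _)).
  by apply/rowP => i; rewrite !mxE expr2.
have [||i j ji|e Be] := diag_eigenbasis_unique (fun k => s k ^+ 2) _ _ (eig _ _ TB TA)
    (eig _ _ TB' TA').
- exact: orthogonal_mul_isometry.
- exact: orthogonal_mul_isometry.
- rewrite eqrXn2 //; move: ji; rewrite neq_ltn => /orP[ji|ij].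
    by rewrite gt_eqF // (le_lt_trans (s_antitone _ _ ji)) // s_lt // (ltn_trans ji).
  by rewrite lt_eqF // (le_lt_trans (s_antitone _ _ ij)) // s_lt.
exists e; have := congr1 (mulmx Q) Be.
by rewrite !mulmxA QQ' !mul1mx.
Qed.

(** * First-order conditions *)

Lemma symmetric_gradients_diag {F : realFieldType} {m n p : nat} (T : 'M[F]_(m, n))
  (A : 'M[F]_(m, p)) (B : 'M[F]_(n, p)) (mu : 'rV[F]_p) :
  A^T *m A = 1%:M -> B^T *m B = 1%:M ->
  (forall i, 0 < mu 0 i) -> injective (mu 0) ->
  (T *m B *m diag_mx mu *m A^T)^T = T *m B *m diag_mx mu *m A^T ->
  (T^T *m A *m diag_mx mu *m B^T)^T = T^T *m A *m diag_mx mu *m B^T ->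
  exists d, T *m B = A *m diag_mx d /\ T^T *m A = B *m diag_mx d.
Proof.
move=> AA BB mu_gt0 mu_inj; rewrite !trmx_mul !trmxK !tr_diag_mx => GA GB.
set N := diag_mx mu in GA GB; set M := A^T *m T *m B.
have E1 : T *m B *m N = A *m N *m M^T.
  by rewrite -[LHS]mulmx1 -AA !mulmxA -GA /M !trmx_mul trmxK !mulmxA.
have E2 : T^T *m A *m N = B *m N *m M.
  by rewrite -[LHS]mulmx1 -BB !mulmxA -GB /M !mulmxA.
have MN : M *m N = N *m M^T.
  by rewrite /M -!mulmxA (mulmxA T) E1 !mulmxA AA mul1mx.
have MN' : M^T *m N = N *m M.
  by rewrite {1}/M !trmx_mul trmxK -!mulmxA (mulmxA T^T) E2 !mulmxA BB mul1mx.
have MNN : M *m (N *m N) = N *m N *m M by rewrite mulmxA MN -mulmxA MN' mulmxA.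
pose d := \row_i M i i.
have Md : M = diag_mx d.
  apply/matrixP => i j; rewrite !mxE; case: eqVneq => [->|ij]; first by rewrite mulr1n.
  (* This entry reads [M i j * (mu_j^2 - mu_i^2) = 0]; positivity makes the squares of distinct
     weights distinct. *)
  have /matrixP/(_ i j) := MNN; rewrite mulmx_diag.
  rewrite mul_mx_diag mul_diag_mx !mxE -!expr2 mulrC mulr0n => /eqP.
  rewrite -subr_eq0 -mulrBl mulf_eq0 subr_eq0 eqrXn2 ?ltW // => /orP[|/eqP //].
  by move=> /eqP/mu_inj e; rewrite e eqxx in ij.
(* The inverse of [N] cancels it from [E1] and [E2], since [M], now diagonal, commutes with it. *)
have NV : N *m diag_mx (\row_i (mu 0 i)^-1) = 1%:M.
  rewrite mulmx_diag -[RHS]diag_const_mx; congr diag_mx; apply/rowP => i.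
  by rewrite !mxE divff // gt_eqF.
exists d; split.
  rewrite -[LHS]mulmx1 -NV mulmxA E1 Md tr_diag_mx -(mulmxA A) diag_mxC -!mulmxA.
  by rewrite NV mulmx1.
rewrite -[LHS]mulmx1 -NV mulmxA E2 Md -(mulmxA B) diag_mxC -!mulmxA.
by rewrite NV mulmx1.
Qed.

Lemma f_cca_swap {R : realType} {dx dy p : nat} (S : 'M[R]_(dx, dy)) (mu : 'rV[R]_p)
  (U : 'M[R]_(dx, p)) (V : 'M[R]_(dy, p)) :
  f_cca S^T (diag_mx mu) V U = f_cca S (diag_mx mu) U V.
Proof.
by rewrite /f_cca -mxtrace_tr !trmx_mul !trmxK tr_diag_mx mxtrace_mulC !mulmxA.
Qed.

(* Curves moving only the first factor: by [f_cca_swap] they suffice for both factors. *)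
Definition stationary_l {R : realType} {dx dy p : nat} (Sxx : 'M[R]_dx)
  (S : 'M[R]_(dx, dy)) (N : 'M[R]_p) (U : 'M[R]_(dx, p)) (V : 'M[R]_(dy, p)) : Prop :=
  forall g : R -> 'M[R]_(dx, p),
    (forall t, (g t)^T *m Sxx *m g t = 1%:M) -> g 0 = U -> (forall t, derivable g t 1) ->
    is_derive (0 : R) (1 : R) (fun t => f_cca S N (g t) V) 0.

Lemma critical_stationary {R : realType} {dx dy p : nat} (Sxx : 'M[R]_dx) (Syy : 'M[R]_dy)
  (S : 'M[R]_(dx, dy)) (mu : 'rV[R]_p) (U : 'M[R]_(dx, p)) (V : 'M[R]_(dy, p)) :
  critical_pt Sxx Syy S (diag_mx mu) U V ->
  stationary_l Sxx S (diag_mx mu) U V /\ stationary_l Syy S^T (diag_mx mu) V U.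
Proof.
move=> [[UU VV] crit]; split=> g gn g0 gd.
  by apply: (crit g (fun=> V)) => //; apply: filterE => t; split.
have -> : (fun t => f_cca S^T (diag_mx mu) (g t) U) = (fun t => f_cca S (diag_mx mu) U (g t)).
  by apply/funext => t; rewrite f_cca_swap.
by apply: (crit (fun=> U) g) => //; apply: filterE => t; split.
Qed.

(** Along an admissible curve the objective is smallest at 0, an interior point of ]-1, 1[, so its
    derivative vanishes there. The argument needs the curve to be feasible and differentiable at
    every such [t], as [stationary_l] provides. *)
Lemma minimizer_stationary {R : realType} {dx dy p : nat} (Sxx : 'M[R]_dx) (Syy : 'M[R]_dy)
  (S : 'M[R]_(dx, dy)) (mu : 'rV[R]_p) (U : 'M[R]_(dx, p)) (V : 'M[R]_(dy, p)) :
  minimizer Sxx Syy S (diag_mx mu) U V ->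
  stationary_l Sxx S (diag_mx mu) U V /\ stationary_l Syy S^T (diag_mx mu) V U.
Proof.
have local_min (h : R -> R) : (forall t, derivable h t 1) -> (forall t, h 0 <= h t) ->
    is_derive (0 : R) (1 : R) h 0.
  move=> hd h0; have le1 : (-1 : R) <= 1 by rewrite (le_trans (lerN10 R)) ?ler01.
  have in0 : (0 : R) \in `]-1, 1[ by rewrite in_itv /= ltrN10 ltr01.
  exact: (derive1_at_min le1 (fun t _ => hd t) in0 (fun t _ => h0 t)).
move=> [[UU VV] umin]; split=> g gn g0 gd; apply: local_min => t.
- have dg := derivableP (gd t).
  by have [] := is_derive_f_cca S (diag_mx mu) dg (is_derive_cst V t 1).
- by rewrite g0; apply: umin; split.
- have dg := derivableP (gd t).
  by have [] := is_derive_f_cca S^T (diag_mx mu) dg (is_derive_cst U t 1).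
- by rewrite g0 !f_cca_swap; apply: umin; split.
Qed.

Lemma mxtrace_delta_mul {R : comPzRingType} {d : nat} (i j : 'I_d) (G : 'M[R]_d) :
  \tr (delta_mx i j *m G) = G j i.
Proof.
rewrite /mxtrace (bigD1 i) //= mxE (bigD1 j) //= mxE !eqxx mul1r.
rewrite big1 => [|k kj]; last by rewrite mxE (negbTE kj) andbF mul0r.
rewrite big1 ?addr0 // => k ki; rewrite mxE big1 // => l _.
by rewrite mxE (negbTE ki) mul0r.
Qed.

Lemma psd_sqrt_unit {R : realType} {d : nat} (S H : 'M[R]_d) :
  is_psd_sqrt S H -> posdef S -> H^T = H /\ H \in unitmx.
Proof.
move=> [[HT _] HH] [_ pd]; split=> //; rewrite -row_free_unit.
apply: inj_row_free => v vH; apply/eqP/negPn/negP => v0.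
have := pd v^T; rewrite trmx_eq0 => /(_ v0).
by rewrite trmxK -HH mulmxA vH !mul0mx mxE ltxx.
Qed.

(* Rotating the columns of [H *m U] keeps [U] on its generalized Stiefel manifold, and the
   velocities of plane rotations span the skew-symmetric matrices. *)
Lemma stationary_gradient_sym {R : realType} {dx dy p : nat} (Sxx H : 'M[R]_dx)
  (S : 'M[R]_(dx, dy)) (N : 'M[R]_p) (U : 'M[R]_(dx, p)) (V : 'M[R]_(dy, p)) :
  H^T = H -> H \in unitmx -> H *m H = Sxx -> U^T *m Sxx *m U = 1%:M ->
  stationary_l Sxx S N U V ->
  (invmx H *m S *m V *m N *m (H *m U)^T)^T = invmx H *m S *m V *m N *m (H *m U)^T.
Proof.
move=> HT Hu HH UU st; set G := invmx H *m _ *m _ *m _ *m _.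
apply/matrixP => i j; rewrite mxE; case: (eqVneq i j) => [->//|ij].
pose g t := invmx H *m givens_mx i j t *m (H *m U).
have IT : (invmx H)^T = invmx H by rewrite trmx_inv HT.
have gd (t : R) : is_derive t (1 : R) g
    (invmx H *m (- sin t *: (delta_mx i i + delta_mx j j)
       + cos t *: (delta_mx i j - delta_mx j i)) *m (H *m U)).
  have := is_derive_mulmx (is_derive_mulmx (is_derive_cst (invmx H) t 1)
    (is_derive_givens_mx i j t)) (is_derive_cst (H *m U) t 1).
  by rewrite mul0mx add0r mulmx0 addr0.
have gn t : (g t)^T *m Sxx *m g t = 1%:M.
  rewrite /g -HH !trmx_mul IT HT -!mulmxA (mulmxA H (invmx H)) mulmxV // mul1mx.
  rewrite (mulmxA (invmx H) H) mulVmx // mul1mx.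
  rewrite (mulmxA (givens_mx i j t)^T) givens_mx_orthogonal // mul1mx.
  by rewrite (mulmxA H H) HH mulmxA.
have g0 : g 0 = U by rewrite /g givens_mx0 mulmx1 mulmxA mulVmx // mul1mx.
have := st g gn g0 (fun t => @ex_derive _ _ _ _ _ _ _ (gd t)).
have := is_derive_f_cca S N (gd 0) (is_derive_cst V (0 : R) 1).
move=> d1 d2; have := @derive_val _ _ _ _ _ _ _ d1; rewrite (@derive_val _ _ _ _ _ _ _ d2).
rewrite mulmx0 mul0mx raddf0 addr0 sin0 cos0 oppr0 scale0r add0r scale1r.
move/esym/eqP; rewrite oppr_eq0 => /eqP.
(* The vanishing derivative is the trace of [G] against the transposed generator of the rotation,
   that is [G i j - G j i]. *)
rewrite (trmx_mul (invmx H *m _)) (trmx_mul (invmx H)) IT raddfB /= !trmx_delta.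
rewrite -!mulmxA mxtrace_mulC -!mulmxA.
have -> : invmx H *m (S *m (V *m (N *m (H *m U)^T))) = G by rewrite /G !mulmxA.
rewrite mulmxBl raddfB /= !mxtrace_delta_mul => /eqP.
by rewrite subr_eq0 => /eqP ->.
Qed.

(** * Canonical correlation equations by columns, and the theorem *)

Lemma col_mulmx_diag {R : comPzRingType} {m p : nat} (A : 'M[R]_(m, p)) (d : 'rV[R]_p) i :
  col i (A *m diag_mx d) = d 0 i *: col i A.
Proof. by apply/colP => k; rewrite mul_mx_diag !mxE mulrC. Qed.

(** Bridge between the columnwise form used in [coordinated] and the matrix equations of the
    first-order conditions; [d] lists the scalars [beta]. *)
Lemma coordinated_colsP {R : realType} {dx dy p : nat} (Hx : 'M[R]_dx) (Hy : 'M[R]_dy)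
  (T : 'M[R]_(dx, dy)) (U : 'M[R]_(dx, p)) (V : 'M[R]_(dy, p)) (d : 'rV[R]_p) :
  (forall i, T *m (Hy *m col i V) = d 0 i *: (Hx *m col i U) /\
             T^T *m (Hx *m col i U) = d 0 i *: (Hy *m col i V)) <->
  (T *m (Hy *m V) = Hx *m U *m diag_mx d /\ T^T *m (Hx *m U) = Hy *m V *m diag_mx d).
Proof.
have colM k l (C : 'M[R]_(k, l)) (W : 'M[R]_(l, p)) i : C *m col i W = col i (C *m W).
  by rewrite !colE mulmxA.
have colsP k (W W' : 'M[R]_(k, p)) : (forall i, col i W = col i W') -> W = W'.
  by move=> WW; apply/matrixP => a i; have /colP/(_ a) := WW i; rewrite !mxE.
split=> [E|[E1 E2] i]; last by rewrite !colM E1 E2 !col_mulmx_diag.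
by split; apply: colsP => i; have [E1 E2] := E i;
  rewrite col_mulmx_diag -!colM ?E1 ?E2.
Qed.

Theorem theorem4p2 (R : realType) (n dx dy : nat)
  (X : 'M[R]_(n, dx)) (Y : 'M[R]_(n, dy)) (lx ly : R)
  (hlx : 0 <= lx) (hly : 0 <= ly)
  (pdx : posdef (Sig_xx X lx)) (pdy : posdef (Sig_xx Y ly))
  (p : nat) (hp1 : (1 <= p)%N) (hp2 : (p <= minn dx dy)%N)
  (mu : 'rV[R]_p)
  (hmu_dec : forall i j : 'I_p, (i < j)%N -> mu 0 j < mu 0 i)
  (hmu_pos : forall i : 'I_p, 0 < mu 0 i)
  (Hx : 'M[R]_dx) (Hy : 'M[R]_dy)
  (hHx : is_psd_sqrt (Sig_xx X lx) Hx) (hHy : is_psd_sqrt (Sig_xx Y ly) Hy)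
  (s : nat -> R)
  (hs : singular_values (invmx Hx *m Sig_xy X Y *m invmx Hy) s) :
  let Sxx := Sig_xx X lx in
  let Syy := Sig_xx Y ly in
  let Sxy := Sig_xy X Y in
  let N := diag_mx mu in
  let Rm := invmx Hx *m Sxy *m invmx Hy in
  (forall (U : 'M[R]_(dx, p)) (V : 'M[R]_(dy, p)), in_Sxy Sxx Syy U V ->
     (critical_pt Sxx Syy Sxy N U V <-> coordinated Hx Hy Rm U V)) /\
  (forall (U : 'M[R]_(dx, p)) (V : 'M[R]_(dy, p)), in_Sxy Sxx Syy U V ->
     (minimizer Sxx Syy Sxy N U V <->
      [/\ critical_pt Sxx Syy Sxy N U V, coordinated_top Hx Hy Rm s U V
        & same_phase X Y U V])) /\
  ((forall k : nat, (k < p)%N -> s k.+1 < s k) ->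
   forall (U U' : 'M[R]_(dx, p)) (V V' : 'M[R]_(dy, p)),
     minimizer Sxx Syy Sxy N U V -> minimizer Sxx Syy Sxy N U' V' ->
     exists (e1 e2 : 'I_p -> bool),
       U' = U *m @sign_mx R p e1 /\ V' = V *m @sign_mx R p e2).
Proof.
move=> Sxx Syy Sxy N Rm.
have [HxT Hxu] := psd_sqrt_unit _ _ hHx pdx; have [HyT Hyu] := psd_sqrt_unit _ _ hHy pdy.
have [[_ HHx] [_ HHy]] := (hHx, hHy); rewrite -/Sxx in HHx; rewrite -/Syy in HHy.
have [s_ge0 [s_dec [s_0 [P [Q [PP [QQ RmE]]]]]]] := hs.
rewrite -/Rm -/(sv_mx dx dy s) in RmE.
have [pdx' pdy'] : (p <= dx)%N /\ (p <= dy)%N by apply/andP; rewrite -leq_min.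
have SxyE : Sxy = Hx *m Rm *m Hy.
  by rewrite /Rm !mulmxA mulmxV // mul1mx -mulmxA mulVmx // mulmx1.
have RmV (V : 'M[R]_(dy, p)) : Rm *m (Hy *m V) = invmx Hx *m Sxy *m V.
  by rewrite /Rm -!mulmxA (mulmxA (invmx Hy)) mulVmx // mul1mx.
have RmU (U : 'M[R]_(dx, p)) : Rm^T *m (Hx *m U) = invmx Hy *m Sxy^T *m U.
  rewrite /Rm !trmx_mul !trmx_inv HxT HyT -!mulmxA (mulmxA (invmx Hx)) mulVmx //.
  by rewrite mul1mx.
clearbody Rm.
have normU (U : 'M[R]_(dx, p)) : (Hx *m U)^T *m (Hx *m U) = U^T *m Sxx *m U.
  by rewrite trmx_mul HxT -HHx !mulmxA.
have normV (V : 'M[R]_(dy, p)) : (Hy *m V)^T *m (Hy *m V) = V^T *m Syy *m V.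
  by rewrite trmx_mul HyT -HHy !mulmxA.
(* The diagonal of [M U V] carries the objective ([fE]), the phases ([phaseE]) and, for coordinated
   columns, the scalars [beta] ([Md]). *)
pose M (U : 'M[R]_(dx, p)) (V : 'M[R]_(dy, p)) := (Hx *m U)^T *m Rm *m (Hy *m V).
have ME U V : M U V = U^T *m Sxy *m V by rewrite /M SxyE trmx_mul HxT !mulmxA.
have fE U V : f_cca Sxy N U V = - \sum_i mu 0 i * M U V i i.
  rewrite /f_cca -ME; congr (- _); apply: eq_bigr => i _.
  by rewrite mul_mx_diag mxE mulrC.
have phaseE U V i : ((col i U)^T *m X^T *m Y *m col i V) 0 0 = M U V i i.
  rewrite ME /Sxy /Sig_xy tr_col -!row_mul !mulmxA.
  by rewrite colE mulmxA -colE [LHS]mxE [LHS]mxE.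
have Md U V d : in_Sxy Sxx Syy U V -> Rm *m (Hy *m V) = Hx *m U *m diag_mx d ->
    forall i, M U V i i = d 0 i.
  move=> [UU _] E i; rewrite /M -mulmxA E mulmxA normU UU mul1mx mxE eqxx.
  by rewrite mulr1n.
have mu_inj : injective (mu 0).
  move=> i j e; case: (ltngtP i j) => [/hmu_dec|/hmu_dec|ij]; rewrite ?e ?ltxx //.
  exact: val_inj.
have coordinated_of_stationary U V : in_Sxy Sxx Syy U V ->
    stationary_l Sxx Sxy N U V /\ stationary_l Syy Sxy^T N V U ->
    exists d, Rm *m (Hy *m V) = Hx *m U *m diag_mx d /\
              Rm^T *m (Hx *m U) = Hy *m V *m diag_mx d.
  move=> [UU VV] [sU sV].
  apply: (symmetric_gradients_diag _ _ _ mu); rewrite ?normU ?normV //.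
    by rewrite RmV; exact: stationary_gradient_sym sU.
  by rewrite RmU; exact: stationary_gradient_sym sV.
have critical_of_coordinated U V d : in_Sxy Sxx Syy U V ->
    Rm *m (Hy *m V) = Hx *m U *m diag_mx d /\ Rm^T *m (Hx *m U) = Hy *m V *m diag_mx d ->
    critical_pt Sxx Syy Sxy N U V.
  move=> UV [E1 E2].
  apply: (critical_of_diag_gradients _ _ _ _ d _ _ (proj1 pdx) (proj1 pdy) UV).
    by rewrite SxyE -!mulmxA E1 !mulmxA HHx.
  by rewrite SxyE !trmx_mul HxT HyT -!mulmxA E2 !mulmxA HHy.
have trace_le U V : in_Sxy Sxx Syy U V -> \sum_i mu 0 i * M U V i i <= \sum_i mu 0 i * s i.
  by move=> [UU VV]; rewrite /M RmE; apply: trace_inequality; rewrite ?normU ?normV.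
have trace_eq U V : in_Sxy Sxx Syy U V ->
    \sum_i mu 0 i * M U V i i = \sum_i mu 0 i * s i -> forall i, M U V i i = s i.
  by move=> [UU VV]; rewrite /M RmE; apply: trace_equality; rewrite ?normU ?normV.
(* The first [p] singular vectors, pulled back by the inverse square roots, attain the trace bound,
   which is therefore the minimal value. *)
have [U0 [V0 [UV0 f0]]] : exists U0 V0, in_Sxy Sxx Syy U0 V0 /\
    f_cca Sxy N U0 V0 = - \sum_i mu 0 i * s i.
  pose U0 := invmx Hx *m (P *m (pid_mx p : 'M[R]_(dx, p))).
  pose V0 := invmx Hy *m (Q *m (pid_mx p : 'M[R]_(dy, p))).
  have HU0 : Hx *m U0 = P *m pid_mx p by rewrite mulmxA mulmxV // mul1mx.
  have HV0 : Hy *m V0 = Q *m pid_mx p by rewrite mulmxA mulmxV // mul1mx.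
  have pid1 k : (p <= k)%N -> (pid_mx p : 'M[R]_(p, k)) *m (pid_mx p : 'M[R]_(k, p)) = 1%:M.
    by move=> pk; rewrite pid_mx_id // pid_mx_1.
  have M0 : M U0 V0 = diag_mx (\row_i s i).
    rewrite /M HU0 HV0 RmE trmx_mul tr_pid_mx -!mulmxA (mulmxA Q^T) QQ mul1mx.
    by rewrite (mulmxA P^T) PP mul1mx sv_mx_mul_pid // mulmxA pid1 // mul1mx.
  exists U0, V0; split.
    split; rewrite -?normU -?normV ?HU0 ?HV0 trmx_mul tr_pid_mx -mulmxA.
      by rewrite (mulmxA P^T) PP mul1mx pid1.
    by rewrite (mulmxA Q^T) QQ mul1mx pid1.
  by rewrite fE M0; congr (- _); apply: eq_bigr => i _; rewrite !mxE eqxx mulr1n.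
(* A minimizer is coordinated with some diagonal [d]; it does at least as well as [U0], [V0], so the
   equality case of the trace inequality gives [d 0 i = s i]. *)
have minimizer_svd U V : minimizer Sxx Syy Sxy N U V ->
    Rm *m (Hy *m V) = Hx *m U *m diag_mx (\row_i s i) /\
    Rm^T *m (Hx *m U) = Hy *m V *m diag_mx (\row_i s i).
  move=> UVmin; have [UV fmin] := UVmin.
  have [d [E1 E2]] := coordinated_of_stationary U V UV (minimizer_stationary _ _ _ _ _ _ UVmin).
  have Ms : forall i, M U V i i = s i.
    apply: trace_eq => //; apply/le_anti; rewrite trace_le //=.
    by have := fmin _ _ UV0; rewrite f0 fE lerN2.
  have <- : d = \row_i s i by apply/rowP => i; rewrite mxE -Ms (Md _ _ d).
  by [].
split; [|split].
- move=> U V UV; split=> [/critical_stationary st|coord].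
    have [d /coordinated_colsP E] := coordinated_of_stationary U V UV st.
    by move=> i; exists (d 0 i).
  apply: (critical_of_coordinated _ _ (\row_i sval (cid (coord i))) UV).
  by apply/coordinated_colsP => i; rewrite mxE; exact: svalP (cid (coord i)).
- move=> U V UV; split=> [UVmin|[_ top phase]].
    have E := minimizer_svd U V UVmin; split.
    + exact: critical_of_coordinated UV E.
    + move=> i; exists (s i); have [E1 E2] := (coordinated_colsP _ _ _ _ _ _).2 E i.
      by rewrite mxE in E1 E2; rewrite ger0_norm.
    + by move=> i; rewrite phaseE (Md _ _ _ UV (proj1 E)) mxE.
  split=> // U' V' UV'; rewrite !fE lerN2 (le_trans (trace_le _ _ UV')) //.
  pose d := \row_i sval (cid (top i)).
  have [E _] : Rm *m (Hy *m V) = Hx *m U *m diag_mx d /\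
               Rm^T *m (Hx *m U) = Hy *m V *m diag_mx d.
    by apply/coordinated_colsP => i; rewrite mxE; have [? []] := svalP (cid (top i)).
  (* [d 0 i] is nonnegative by the phase condition and has absolute value [s i], so the trace bound
     is attained. *)
  rewrite le_eqVlt; apply/orP; left; apply/eqP/eq_bigr => i _; congr (_ * _).
  have := phase i; rewrite phaseE (Md _ _ _ UV E) => d_ge0.
  rewrite -[RHS]ger0_norm // /d mxE.
  by have [_ []] := svalP (cid (top i)).
- move=> s_lt U U' V V' UVmin UVmin'.
  have [[[UU VV] _] [[UU' VV'] _]] := (UVmin, UVmin').
  have [E1 E2] := minimizer_svd _ _ UVmin; have [E1' E2'] := minimizer_svd _ _ UVmin'.
  have RmTE : Rm^T = Q *m sv_mx dy dx s *m P^T.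
    by rewrite RmE !trmx_mul trmxK tr_sv_mx mulmxA.
  rewrite -normU in UU; rewrite -normU in UU'; rewrite -normV in VV; rewrite -normV in VV'.
  have sdx k : (dx <= k)%N -> s k = 0 by move=> dk; apply: s_0; rewrite geq_min dk.
  have sdy k : (dy <= k)%N -> s k = 0 by move=> dk; apply: s_0; rewrite geq_min dk orbT.
  (* The left singular vectors of [Rm] are right singular vectors of [Rm^T], so the same lemma
     applies with [P] and [Q] exchanged. *)
  have [e1 Ue] : exists e : 'I_p -> bool, Hx *m U' = Hx *m U *m sign_mx R e.
    apply: (right_singular_vectors_unique Q P s (Hy *m V) (Hy *m V')) => //;
    by rewrite -RmTE ?trmxK.
  have [e2 Ve] : exists e : 'I_p -> bool, Hy *m V' = Hy *m V *m sign_mx R e.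
    by apply: (right_singular_vectors_unique P Q s (Hx *m U) (Hx *m U')); rewrite -?RmE.
  exists e1, e2; split.
    by rewrite -[LHS]mul1mx -(mulVmx Hxu) -mulmxA Ue !mulmxA mulVmx // mul1mx.
  by rewrite -[LHS]mul1mx -(mulVmx Hyu) -mulmxA Ve !mulmxA mulVmx // mul1mx.
Qed.
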